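(* Let $G$ be a graph, let $V(G)=V_1\cup V_2$ be a partition of its vertex set with $V_2\neq\emptyset$, and let $X\subseteq V_1$ be the vertex boundary of $V_2$ in $G$. Let $H$ be a connected graph with $|H|\ge|V_2|$ and let $G':=(G[V_1],X)\vee H$. Suppose there is $M\in S(G)$ such that $M[V_2]$ has distinct eigenvalues $\lambda_1,\dots,\lambda_{|V_2|}$. Let $t=|H|-|V_2|$ and let $\mu_1,\dots,\mu_t$ be any distinct real numbers with $\mu_i\neq\lambda_j$ for all $i\in[t]$, $j\in[|V_2|]$. Then there exists $N\in S(G')$ with spectrum $\sigma(N)=\sigma(M)\cup\{\mu_1,\dots,\mu_t\}$ (union of multisets).
   Context: $S(G)$ is the set of real symmetric matrices indexed by $V(G)$ whose $(i,j)$ off-diagonal entry is nonzero iff $\{i,j\}\in E(G)$ (diagonal unrestricted). $G[W]$ is the induced subgraph and $M[W]$ the principal submatrix on $W$; $\sigma(\cdot)$ is the spectrum as a multiset. The vertex boundary of $W\subseteq V(G)$ is the set of vertices outside $W$ adjacent to some vertex of $W$. For disjoint graphs $G_1,G_2$ and $U_1\subseteq V(G_1)$, the partial join $(G_1,U_1)\vee G_2$ is $G_1\cup G_2$ together with all edges joining each vertex of $U_1$ to each vertex of $G_2$. *)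

(* Defs.v *)
From HB Require Import structures.
From mathcomp Require Import all_boot all_order all_algebra.
From mathcomp Require Import Rstruct.
From Stdlib Require Rdefinitions.
Unset Printing Implicit Defensive.
Import Order.TTheory GRing.Theory Num.Theory.
Local Open Scope ring_scope.

Definition simple_graph {T : finType} (e : rel T) : Prop :=
  symmetric e /\ irreflexive e.

Definition graph_connected {T : finType} (e : rel T) : Prop :=
  forall x y : T, connect e x y.

Definition in_S {T : finType} (e : rel T) (M : T -> T -> Rdefinitions.R) : Prop :=
  (forall x y, M x y = M y x) /\
  (forall x y, x != y -> (M x y != 0) = e x y).

Definition mx_of {T : finType} (M : T -> T -> Rdefinitions.R) : 'M[Rdefinitions.R]_#|T| :=
  \matrix_(i, j) M (enum_val i) (enum_val j).

Definition principal_submx {T : finType} (M : T -> T -> Rdefinitions.R) (W : {set T})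
  : 'M[Rdefinitions.R]_#|W| :=
  \matrix_(i, j) M (@enum_val T (mem W) i) (@enum_val T (mem W) j).

Definition vboundary {T : finType} (e : rel T) (W : {set T}) : {set T} :=
  [set x | (x \notin W) && [exists y, (y \in W) && e x y]].

Definition pjoin {T U : finType} (e : rel T) (V1 X : {set T}) (eH : rel U)
  : rel ({x : T | x \in V1} + U)%type :=
  fun a b =>
    match a, b with
    | inl x, inl y => e (val x) (val y)
    | inr u, inr v => eH u v
    | inl x, inr _ => val x \in X
    | inr _, inl y => val y \in X
    end.

(* Main.v *)
(** Write M[V2] = Q diag(lam) Q^T with Q orthogonal. If D = P diag(lam, mu) P^T lies in S(H) with P
    orthogonal, then replacing M[V2] by D and the rows B of M[V1,V2] by [BQ, 0] P^T yields a matrix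
    orthogonally similar to M + diag(mu), and it lies in S(G') as soon as P w has no zero entry for
    the finitely many nonzero vectors w = [row of BQ, 0]^T attached to X.

    Such D and P exist for every connected H, every list of distinct reals and every finite list of
    nonzero vectors w. The vertices of H are added one at a time, each adjacent to an earlier one:
    start from the direct sum of the previous matrix and a 1 x 1 block, put weights x * b on the new
    edges, and correct the diagonal so that the spectrum is exactly preserved. Since the matrix stays
    close to diagonal, the correction is the fixed point of a contraction, and it is continuous in x
    together with the eigenvectors. For the induction one also controls the entries of the adjugates
    adj(s - D) for finitely many s outside the spectrum. *)

From mathcomp Require Import boolp classical_sets functions filter.
From mathcomp Require Import reals interval_inference topology normedtype sequences realfun.
Require Import Defs.
From HB Require Import structures.
From mathcomp Require Import all_boot all_order all_algebra.
From mathcomp Require Import fingroup perm.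
From mathcomp Require Import ring lra.
From mathcomp Require Import Rstruct.
From Stdlib Require Rdefinitions.
Import Order.TTheory GRing.Theory Num.Theory.
Import numFieldNormedType.Exports.
Local Open Scope ring_scope.

Set Implicit Arguments.
Unset Strict Implicit.
Unset Printing Implicit Defensive.

(** * Continuity of determinants and cofactors *)

Section MatrixLimits.
Local Open Scope classical_set_scope.

Lemma cvg_det (R : realType) (T : Type) (F : set_system T) (FF : Filter F) (n : nat)
    (A : T -> 'M[R]_n) (A0 : 'M[R]_n) :
  (forall i j, A x i j @[x --> F] --> A0 i j) ->
  \det (A x) @[x --> F] --> \det A0.
Proof.
move=> cA; rewrite /determinant; apply: cvg_big => [|s _].
  exact: add_continuous.
apply: cvgM; first exact: cvg_cst.
by apply: cvg_big => [|i _]; [exact: mul_continuous|exact: cA].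
Qed.

Lemma cvg_cofactor (R : realType) (T : Type) (F : set_system T) (FF : Filter F) (n : nat)
    (A : T -> 'M[R]_n) (A0 : 'M[R]_n) (i j : 'I_n) :
  (forall i j, A x i j @[x --> F] --> A0 i j) ->
  cofactor (A x) i j @[x --> F] --> cofactor A0 i j.
Proof.
move=> cA; rewrite /cofactor; apply: cvgM; first exact: cvg_cst.
by apply: cvg_det => k l; rewrite !mxE; under eq_fun do rewrite !mxE; exact: cA.
Qed.

End MatrixLimits.

(** * Prescribing eigenvalues by a small change of the diagonal *)

Lemma mx_norm_leP (R : realType) (n : nat) (h : 'rV[R]_n.+1) (x : R) :
  0 <= x -> reflect (forall k, `|h 0 k| <= x) (`|h| <= x).
Proof.
move=> x0; rewrite /Num.norm/= mx_normrE; apply: (iffP idP) => [H k|H].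
  by apply: le_trans H; rewrite (le_bigmax _ (fun ij => `|h ij.1 ij.2|) (0, k)).
by apply: bigmax_le => [//|[i k] _ /=]; rewrite ord1 H.
Qed.

(** The cofactors along row [k] do not involve row [k], so expanding along it shows that the
    determinant is affine in the entry [(k, k)]. *)
Lemma det_add_diag_delta (R : comNzRingType) (n : nat) (A : 'M[R]_n) (t : R) (k : 'I_n) :
  \det (A + t *: delta_mx k k) = \det A + t * cofactor A k k.
Proof.
rewrite (expand_det_row _ k) [in RHS](expand_det_row _ k).
have E j : cofactor (A + t *: delta_mx k k) k j = cofactor A k j.
  rewrite /cofactor; congr (_ * \det _); apply/matrixP => a b; rewrite !mxE.
  by rewrite eq_sym (negPf (neq_lift _ _)) mulr0 addr0.
under eq_bigr do rewrite E !mxE eqxx /= mulrDl.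
rewrite big_split /=; congr (_ + _).
rewrite (bigD1 k) //= eqxx mulr1 big1 ?addr0 // => j /negPf ->.
by rewrite mulr0 mul0r.
Qed.

(** The corners of the path from [d] to [d'] that changes one coordinate at a time. *)
Definition splice {R : nmodType} {n : nat} (d d' : 'rV[R]_n) (k : nat) : 'rV[R]_n :=
  \row_j (if (j < k)%N then d' 0 j else d 0 j).

(** An exact mean value formula: along the path of splices each step changes one diagonal entry, in
    which the determinant is affine. *)
Lemma det_diag_telescope (R : comNzRingType) (n : nat) (A : 'M[R]_n) (d d' : 'rV[R]_n) :
  \det (A - diag_mx d') - \det (A - diag_mx d) =
  - \sum_k (d' 0 k - d 0 k) * cofactor (A - diag_mx (splice d d' k)) k k.
Proof.
pose g k := \det (A - diag_mx (splice d d' k)).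
have -> : \det (A - diag_mx d') = g n.
  by congr (\det (_ - diag_mx _)); apply/rowP => j; rewrite mxE ltn_ord.
have -> : \det (A - diag_mx d) = g 0%N.
  by congr (\det (_ - diag_mx _)); apply/rowP => j; rewrite mxE.
rewrite -(telescope_sumr _ (leq0n n)) big_mkord -sumrN.
apply: eq_bigr => k _; rewrite {1}/g.
suff -> : A - diag_mx (splice d d' k.+1) =
    (A - diag_mx (splice d d' k)) + (d 0 k - d' 0 k) *: delta_mx k k.
  by rewrite det_add_diag_delta /g; ring.
apply/matrixP => i j; rewrite !mxE.
case: (eqVneq i j) => [->|ij]; last first.
  have -> : (i == k) && (j == k) = false.
    by apply: contraNF ij => /andP[/eqP-> /eqP->].
  by rewrite !mulr0n mulr0 addr0.
rewrite !mulr1n ltnS andbb; case: (eqVneq j k) => [->|jk].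
  by rewrite leqnn ltnn mulr1n mulr1; ring.
rewrite mulr0n mulr0 addr0 leq_eqVlt.
by have -> : (j == k :> nat) = false by apply/negbTE.
Qed.

(** Completeness of row vectors in the sup norm, for the Banach fixed point theorem. *)
HB.instance Definition _ (R : realType) (n : nat) := Complete.on 'rV[R]_n.+1.

(** The derivative at [th i] of the monic polynomial with roots [th]. *)
Definition gap {R : fieldType} {n : nat} (th : 'I_n -> R) (i : 'I_n) : R :=
  \prod_(k | k != i) (th i - th k).

(* When [D] has spectrum [th], [cofactor (th i - D) k k / gap th i] is the derivative of the [i]-th
   eigenvalue in the direction of the [k]-th diagonal entry. It equals [(i == k)] if [D] is the
   diagonal matrix of [th]; a small defect makes the contraction below work. *)
Definition defect {R : fieldType} {n : nat} (th : 'I_n -> R) (D : 'M[R]_n) (i k : 'I_n) : R :=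
  (i == k)%:R - cofactor ((th i)%:M - D) k k / gap th i.

Lemma gap_neq0 (R : fieldType) (n : nat) (th : 'I_n -> R) (i : 'I_n) :
  injective th -> gap th i != 0.
Proof.
move=> inj; apply/prodf_neq0 => k ki.
by rewrite subr_eq0; apply: contraNneq ki => /inj ->.
Qed.

Section DiagonalCorrection.
Local Open Scope classical_set_scope.

(* The zeros of [h |-> det (th i - D - diag h)] are the fixed points of
   [h_i + det (th i - D - diag h) / gap th i], a contraction because the determinant is affine in
   each [h_k]. *)
Lemma diagonal_correction (R : realType) (n : nat) (th : 'I_n.+1 -> R) (D : 'M[R]_n.+1) (r : R) :
  injective th -> 0 <= r ->
  (forall h : 'rV[R]_n.+1, `|h| <= 2 * r ->
     forall i k, `|defect th (D + diag_mx h) i k| <= (2 * n.+1%:R)^-1) ->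
  (forall i, `|\det ((th i)%:M - D) / gap th i| <= r) ->
  exists2 h : 'rV[R]_n.+1, `|h| <= 2 * r &
    forall i, \det ((th i)%:M - (D + diag_mx h)) = 0.
Proof.
move=> thI r0 small det_small.
pose T (h : 'rV[R]_n.+1) : 'rV[R]_n.+1 :=
  \row_i (h 0 i + \det ((th i)%:M - (D + diag_mx h)) / gap th i).
pose U := [set h : 'rV[R]_n.+1 | `|h| <= 2 * r].
have r20 : 0 <= 2 * r by rewrite mulr_ge0.
have lipT x y : U x -> U y -> `|T x - T y| <= 2^-1 * `|x - y|.
  move=> Ux Uy; have xy0 : 0 <= 2^-1 * `|x - y| by rewrite mulr_ge0.
  apply/mx_norm_leP => // i; rewrite !mxE.
  (* A ball of the sup norm is a box, so it contains the splices of its points and the defect bound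
     applies to them. *)
  have Us k : U (splice y x k).
    apply/mx_norm_leP => // j; rewrite mxE; case: ifP => _; exact/mx_norm_leP.
  (* The mean value formula for [T]: its partial derivatives are defects. Each of the [n.+1] terms
     has a factor at most [(2 * n.+1%:R)^-1], which gives the contraction constant 1/2. *)
  have -> : x 0 i + \det ((th i)%:M - (D + diag_mx x)) / gap th i -
      (y 0 i + \det ((th i)%:M - (D + diag_mx y)) / gap th i) =
      \sum_k (x 0 k - y 0 k) * defect th (D + diag_mx (splice y x k)) i k.
    have := det_diag_telescope ((th i)%:M - D) y x; rewrite -!addrA -!opprD => tele.
    rewrite [LHS](_ : _ = (x 0 i - y 0 i) + (\det ((th i)%:M - (D + diag_mx x)) -
      \det ((th i)%:M - (D + diag_mx y))) / gap th i); last by ring.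
    rewrite tele mulNr mulr_suml.
    under [RHS]eq_bigr do rewrite mulrBr.
    rewrite sumrB; congr (_ - _).
      rewrite (bigD1 i) //= eqxx mulr1 big1 ?addr0 // => k ki.
      by rewrite eq_sym (negPf ki) mulr0.
    by apply: eq_bigr => k _; rewrite opprD addrA -[LHS]mulrA.
  apply: (le_trans (ler_norm_sum _ _ _)).
  apply: (@le_trans _ _ (\sum_(k < n.+1) (`|x - y| * (2 * n.+1%:R)^-1))).
    apply: ler_sum => k _; rewrite normrM; apply: ler_pM => //; last exact: small (Us k) _ _.
    have H := elimT (mx_norm_leP (x - y) (normr_ge0 (x - y))) (lexx _).
    move: (H k).
    by rewrite !mxE.
  rewrite sumr_const card_ord -[leLHS]mulr_natr -mulrA.
  by rewrite invfM mulfVK ?pnatr_eq0 // mulrC.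
have T0 : `|T 0| <= r.
  apply/mx_norm_leP => // i; rewrite !mxE add0r.
  by rewrite (_ : diag_mx 0 = 0) ?addr0 //; apply/matrixP => ? ?; rewrite !mxE mul0rn.
(* [|T h| <= |T h - T 0| + |T 0| <= r + r], which is why the ball has radius [2 * r]. *)
have TU : set_fun U U T.
  move=> h Uh; rewrite /U /=.
  have U0 : U 0 by rewrite /U /= normr0.
  have := lipT _ _ Uh U0; rewrite subr0 => lip.
  rewrite -(subrK (T 0) (T h)); apply: (le_trans (ler_normD _ _)).
  rewrite mulr_natl mulr2n lerD //; apply: (le_trans lip).
  by rewrite ler_pdivrMl.
have [] := @banach_fixed_point R 'rV[R]_n.+1 U (mkfun_fun TU).
- exists (2^-1)%:nng; split => /=; first by rewrite invf_lt1 // ltr1n.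
  by move=> [x y] /= [Ux Uy]; exact: lipT.
- apply: (@preimage_closed _ _ (fun h : 'rV[R]_n.+1 => `|h|) [set x : R | x <= 2 * r]).
    by move=> h _; exact: norm_continuous.
  exact: closed_le.
- by exists 0; rewrite /U /= normr0.
move=> h Uh hE; exists h => // i.
move/rowP/(_ i): hE; rewrite /= /mkfun mxE => /eqP.
rewrite -subr_eq0 opprD addrA subrr sub0r oppr_eq0 mulf_eq0 invr_eq0.
by rewrite (negPf (gap_neq0 _ thI)) orbF => /eqP.
Qed.

End DiagonalCorrection.

(** * Orthonormal eigenvectors of symmetric matrices with simple spectrum *)

(** A unit eigenvector is determined only up to sign; the signs [s] are chosen so that the columns
    tend to those of a given orthogonal matrix. *)
Definition normalize_cols {R : rcfType} {n : nat} (s : 'I_n -> R) (V : 'M[R]_n) : 'M[R]_n :=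
  \matrix_(i, j) (s j * V i j / Num.sqrt (\sum_k V k j ^+ 2)).

Lemma mul_mx_diagE (R : comNzRingType) (n : nat) (V : 'M[R]_n) (d : 'rV[R]_n) (i j : 'I_n) :
  (V *m diag_mx d) i j = V i j * d 0 j.
Proof. by rewrite mul_mx_diag mxE. Qed.

(** Evaluating [V^T *m D *m W] in two ways gives [(th j - th k) * (V^T *m W) j k = 0]. Two families
    are allowed so that the result also compares two eigenbases. *)
Lemma eigvec_orthogonal (R : fieldType) (n : nat) (D V W : 'M[R]_n) (th : 'I_n -> R) :
  injective th -> D^T = D ->
  D *m V = V *m diag_mx (\row_j th j) -> D *m W = W *m diag_mx (\row_j th j) ->
  forall j k, j != k -> (V^T *m W) j k = 0.
Proof.
move=> thI Dsym DV DW j k jk.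
have : V^T *m D *m W = V^T *m W *m diag_mx (\row_j th j) by rewrite -mulmxA DW mulmxA.
rewrite -[D in LHS]Dsym -trmx_mul DV trmx_mul tr_diag_mx -[LHS]mulmxA.
move=> /matrixP/(_ j k); rewrite mul_mx_diagE mul_diag_mx !mxE => /eqP.
rewrite -subr_eq0 [_ * th k]mulrC -mulrBl mulf_eq0 subr_eq0.
by rewrite (inj_eq thI) (negPf jk) /= => /eqP.
Qed.

Lemma trmx_mul_diagE (R : comNzRingType) (n : nat) (V : 'M[R]_n) (j : 'I_n) :
  (V^T *m V) j j = \sum_k V k j ^+ 2.
Proof. by rewrite mxE; apply: eq_bigr => k _; rewrite mxE expr2. Qed.

Lemma normalize_cols_eigen (R : rcfType) (n : nat) (D V : 'M[R]_n) (th s : 'I_n -> R) :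
  D *m V = V *m diag_mx (\row_j th j) ->
  D *m normalize_cols s V = normalize_cols s V *m diag_mx (\row_j th j).
Proof.
move=> DV.
have -> : normalize_cols s V = V *m diag_mx (\row_j (s j / Num.sqrt (\sum_k V k j ^+ 2))).
  by apply/matrixP => i j; rewrite mul_mx_diagE !mxE mulrAC mulrC.
by rewrite mulmxA DV -!mulmxA; congr (_ *m _); exact: diag_mxC.
Qed.

Lemma normalize_cols_orthogonal (R : rcfType) (n : nat) (D V : 'M[R]_n) (th s : 'I_n -> R) :
  injective th -> D^T = D -> D *m V = V *m diag_mx (\row_j th j) ->
  (forall j, s j ^+ 2 = 1) -> (forall j, \sum_k V k j ^+ 2 != 0) ->
  (normalize_cols s V)^T *m normalize_cols s V = 1%:M.
Proof.
move=> thI Dsym DV s1 V0; apply/matrixP => j k; rewrite [RHS]mxE.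
case: (eqVneq j k) => [<-|jk]; last first.
  by rewrite (eigvec_orthogonal thI Dsym _ _ jk) //; exact: normalize_cols_eigen.
rewrite trmx_mul_diagE.
have sq : Num.sqrt (\sum_k V k j ^+ 2) ^+ 2 = \sum_k V k j ^+ 2.
  by rewrite sqr_sqrtr // sumr_ge0 // => i _; exact: sqr_ge0.
under eq_bigr do rewrite mxE exprMn exprVn exprMn s1 mul1r sq.
by rewrite -mulr_suml divff.
Qed.

(** Expand column [j] of [V] in the orthonormal basis [P]: only the coefficient along column [j]
    survives. *)
Lemma eigvec_unique (R : fieldType) (n : nat) (D P V : 'M[R]_n) (th : 'I_n -> R) :
  injective th -> D^T = D -> P^T *m P = 1%:M ->
  D *m P = P *m diag_mx (\row_j th j) -> D *m V = V *m diag_mx (\row_j th j) ->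
  forall i j, V i j = P i j * (P^T *m V) j j.
Proof.
move=> thI Dsym PP DP DV i j.
rewrite -[V in LHS]mul1mx -(mulmx1C PP) -mulmxA mxE (bigD1 j) //= big1 ?addr0 // => k kj.
by rewrite (eigvec_orthogonal thI Dsym DP DV kj) mulr0.
Qed.

(** Eigenvectors that are polynomial in [D], hence continuous. Column [j] of the adjugate is used
    because its entry [j] is the cofactor occurring in [defect th D j j], nonzero when that defect
    is small. *)
Definition adj_eigvecs {R : comNzRingType} {n : nat} (th : 'I_n -> R) (D : 'M[R]_n) : 'M[R]_n :=
  \matrix_(i, j) \adj ((th j)%:M - D) i j.

Lemma adj_eigvecsP (R : comNzRingType) (n : nat) (th : 'I_n -> R) (D : 'M[R]_n) :
  (forall j, \det ((th j)%:M - D) = 0) ->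
  D *m adj_eigvecs th D = adj_eigvecs th D *m diag_mx (\row_j th j).
Proof.
move=> det0; apply/matrixP => i j; rewrite mul_mx_diagE mxE.
have := mul_mx_adj ((th j)%:M - D); rewrite det0 raddf0 mulmxBl mul_scalar_mx.
move=> /matrixP/(_ i j); rewrite !mxE => /eqP; rewrite subr_eq0 mulrC => /eqP ->.
by apply: eq_bigr => k _; rewrite !mxE.
Qed.

Lemma det_eigen0 (R : fieldType) (n : nat) (D P : 'M[R]_n) (d : 'rV[R]_n) (s : R) :
  P \in unitmx -> D *m P = P *m diag_mx d ->
  \det (s%:M - D) = \prod_j (s - d 0 j).
Proof.
move=> Pu DP; have : (s%:M - D) *m P = P *m diag_mx (\row_j (s - d 0 j)).
  rewrite mulmxBl DP mul_scalar_mx -mul_mx_scalar -mulmxBr; congr (P *m _).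
  by apply/matrixP => i j; rewrite !mxE -mulrnBl.
move=> /(congr1 determinant); rewrite !det_mulmx det_diag [RHS]mulrC.
move=> /(mulIf _) ->; last by rewrite -unitfE -unitmxE.
by apply: eq_bigr => j _; rewrite mxE.
Qed.

(** Column [j] of [V] is a nonzero multiple of column [j] of [P]; the sign of the factor is the sign
    to choose. *)
Lemma normalize_cols_limit (R : rcfType) (n : nat) (D P V : 'M[R]_n) (th : 'I_n -> R) :
  injective th -> D^T = D -> P^T *m P = 1%:M ->
  D *m P = P *m diag_mx (\row_j th j) -> D *m V = V *m diag_mx (\row_j th j) ->
  (forall j, \sum_k V k j ^+ 2 != 0) ->
  exists2 s : 'I_n -> R, (forall j, s j ^+ 2 = 1) & normalize_cols s V = P.
Proof.
move=> thI Dsym PP DP DV V0.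
have VE := eigvec_unique thI Dsym PP DP DV.
pose a j := (P^T *m V) j j.
have sumE j : \sum_k V k j ^+ 2 = a j ^+ 2.
  under eq_bigr do rewrite VE exprMn.
  by rewrite -mulr_suml -trmx_mul_diagE PP mxE eqxx mul1r.
have a0 j : a j != 0 by have := V0 j; rewrite sumE expf_eq0.
exists (fun j => Num.sg (a j)) => [j|]; first by rewrite sqr_sg a0.
apply/matrixP => i j; rewrite mxE sumE sqrtr_sqr VE -/(a j).
by rewrite mulrCA -normrEsg mulfK ?normr_eq0.
Qed.

(** * Perturbations that preserve the spectrum, with continuous eigenvectors *)

Section IsospectralPerturbation.
Local Open Scope classical_set_scope.

Lemma cvg_defect (R : realType) (T : Type) (F : set_system T) (FF : Filter F) (n : nat)
    (th : 'I_n -> R) (A : T -> 'M[R]_n) (A0 : 'M[R]_n) (i k : 'I_n) :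
  (forall i j, A x i j @[x --> F] --> A0 i j) ->
  defect th (A x) i k @[x --> F] --> defect th A0 i k.
Proof.
move=> cA; apply: cvgB; first exact: cvg_cst.
apply: cvgM; last exact: cvg_cst.
apply: cvg_cofactor => a b; rewrite !mxE; under eq_fun do rewrite !mxE.
by apply: cvgB; [exact: cvg_cst|exact: cA].
Qed.

Lemma cvg_adj (R : realType) (T : Type) (F : set_system T) (FF : Filter F) (n : nat)
    (s : R) (A : T -> 'M[R]_n) (A0 : 'M[R]_n) (i j : 'I_n) :
  (forall i j, A x i j @[x --> F] --> A0 i j) ->
  \adj (s%:M - A x) i j @[x --> F] --> \adj (s%:M - A0) i j.
Proof.
move=> cA; rewrite mxE; under eq_fun do rewrite mxE.
apply: cvg_cofactor => a b; rewrite !mxE; under eq_fun do rewrite !mxE.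
by apply: cvgB; [exact: cvg_cst|exact: cA].
Qed.

Lemma cvg_charmx_det (R : realType) (T : Type) (F : set_system T) (FF : Filter F) (n : nat)
    (s : R) (A : T -> 'M[R]_n) (A0 : 'M[R]_n) :
  (forall i j, A x i j @[x --> F] --> A0 i j) ->
  \det (s%:M - A x) @[x --> F] --> \det (s%:M - A0).
Proof.
move=> cA; apply: cvg_det => a b; rewrite !mxE; under eq_fun do rewrite !mxE.
by apply: cvgB; [exact: cvg_cst|exact: cA].
Qed.

Lemma cvg_normalize_cols (R : realType) (T : Type) (F : set_system T) (FF : Filter F) (n : nat)
    (s : 'I_n -> R) (A : T -> 'M[R]_n) (A0 : 'M[R]_n) (i j : 'I_n) :
  \sum_k A0 k j ^+ 2 != 0 ->
  (forall i j, A x i j @[x --> F] --> A0 i j) ->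
  normalize_cols s (A x) i j @[x --> F] --> normalize_cols s A0 i j.
Proof.
move=> A00 cA; rewrite mxE; under eq_fun do rewrite mxE.
apply: cvgM; first by apply: cvgM; [exact: cvg_cst|exact: cA].
have sge0 : 0 <= \sum_k A0 k j ^+ 2 by apply: sumr_ge0 => k _; exact: sqr_ge0.
apply: cvgV; first by rewrite sqrtr_eq0 -ltNge lt_neqAle eq_sym A00.
apply: continuous_cvg; first exact: sqrt_continuous.
apply: cvg_big => [|k _]; first exact: add_continuous.
by under eq_fun do rewrite expr2; rewrite expr2; apply: cvgM; exact: cA.
Qed.

Lemma defect_nbhs (R : realType) (n : nat) (th : 'I_n.+1 -> R) (D0 : 'M[R]_n.+1) (c : R) :
  (forall i k, `|defect th D0 i k| < c) ->
  exists2 r : R, 0 < r & forall D : 'M[R]_n.+1, (forall i j, `|D i j - D0 i j| < r) ->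
    forall i k, `|defect th D i k| < c.
Proof.
move=> small.
have : \forall D \near D0, forall i k, `|defect th D i k| < c.
  apply: (filter_forall (nbhs_filter D0)) => i; apply: (filter_forall (nbhs_filter D0)) => k.
  have cvg_coord : forall i j, (D : 'M[R]_n.+1) i j @[D --> D0] --> D0 i j.
    by move=> a b; exact: coord_continuous.
  have := @cvg_defect R _ _ (nbhs_filter D0) _ th id D0 i k cvg_coord.
  by move=> /cvgr_norm_lt; apply.
move=> /nbhs_ballP[r /= r0 ballr]; exists r => // D Dr i k.
by apply: (ballr D); split=> // a b; rewrite /ball /= distrC.
Qed.

(** The diagonal correction of [D0 + x *: B] is bounded by a multiple of the residuals of the
    [th i], which vanish at [x = 0]. The eigenvectors come from adjugates and so follow the
    corrected matrix continuously at 0. *)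
Lemma isospectral_perturbation (R : realType) (n : nat) (th : 'I_n.+1 -> R)
    (D0 B P0 : 'M[R]_n.+1) :
  injective th -> D0^T = D0 -> B^T = B -> P0^T *m P0 = 1%:M ->
  D0 *m P0 = P0 *m diag_mx (\row_j th j) ->
  (forall i k, `|defect th D0 i k| < (2 * n.+1%:R)^-1) ->
  exists (h : R -> 'rV[R]_n.+1) (P : R -> 'M[R]_n.+1),
  [/\ forall k, h x 0 k @[x --> 0] --> 0,
      forall i j, (D0 + x *: B + diag_mx (h x)) i j @[x --> 0] --> D0 i j,
      forall i j, P x i j @[x --> 0] --> P0 i j &
      \forall x \near 0, (P x)^T *m P x = 1%:M /\
        (D0 + x *: B + diag_mx (h x)) *m P x = P x *m diag_mx (\row_j th j)].
Proof.
move=> thI D0sym Bsym PP DP small.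
have [r r0 smallr] := defect_nbhs small.
have Pu : P0 \in unitmx by case/mulmx1_unit: PP.
have det0 i : \det ((th i)%:M - D0) = 0.
  by rewrite (det_eigen0 _ Pu DP) (bigD1 i) //= mxE subrr mul0r.
have cD i j : (D0 + x *: B) i j @[x --> 0] --> D0 i j.
  have : D0 i j + x * B i j @[x --> (0 : R)] --> D0 i j + 0 * B i j.
    apply: cvgD; first exact: cvg_cst.
    by apply: cvgM; [exact: cvg_id|exact: cvg_cst].
  by under [in X in _ -> X]eq_fun do rewrite !mxE; rewrite mul0r addr0.
(* Bounds all residuals at once; it tends to 0 because every [th i] is an eigenvalue of [D0]. *)
pose e (x : R) : R := \sum_i `|\det ((th i)%:M - (D0 + x *: B)) / gap th i|.
have e_ge0 x : 0 <= e x by exact: sumr_ge0.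
have ce : e x @[x --> 0] --> 0.
  rewrite [X in _ --> X](_ : 0 = \sum_i `|\det ((th i)%:M - D0) / gap th i|); last first.
    by rewrite big1 // => i _; rewrite det0 mul0r normr0.
  apply: cvg_big => [|i _]; first exact: add_continuous.
  by apply: cvg_norm; apply: cvgM; [exact: cvg_charmx_det|exact: cvg_cst].
(* The radius [r] is shared: one half for [x *: B], one half for the correction. *)
have nearD : \forall x \near 0, forall i j, `|(D0 + x *: B) i j - D0 i j| < r / 2.
  apply: (filter_forall (nbhs_filter (0 : R))) => i.
  apply: (filter_forall (nbhs_filter (0 : R))) => j.
  have /cvgr_distC_lt := cD i j; apply; by rewrite divr_gt0.
have neare : \forall x \near 0, 2 * e x < r / 2.
  have r40 : 0 < r / 4 by rewrite divr_gt0.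
  near=> x; have : `|e x - 0| < r / 4.
    by near: x; have /cvgr_distC_lt := ce; apply.
  by rewrite subr0 ger0_norm // => ex; lra.
pose good x (h : 'rV[R]_n.+1) := `|h| <= 2 * e x /\
  forall i, \det ((th i)%:M - (D0 + x *: B + diag_mx h)) = 0.
(* [h x] is a valid correction whenever one exists and 0 otherwise. The bound on its size alone
   gives its limit at 0. *)
have /choice[h hP] : forall x, exists h, (exists h', good x h') -> good x h.
  move=> x; have [[h' H]|H] := pselect (exists h', good x h'); first by exists h'.
  by exists 0 => /H.
have nearh : \forall x \near 0, good x (h x).
  near=> x; apply: hP.
  have hr : 2 * e x < r / 2 by near: x.
  have [||i|g hg detg] := @diagonal_correction R n th (D0 + x *: B) (e x) thI.
  - exact: e_ge0.
  - move=> g gx i k; apply/ltW/smallr => a b.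
    have : `|(D0 + x *: B) a b - D0 a b| < r / 2 by move: a b; near: x.
    move=> H; rewrite [_ a b]mxE addrAC; apply: (le_lt_trans (ler_normD _ _)).
    rewrite (splitr r) ltrD //; apply: le_lt_trans hr; apply: le_trans gx.
    rewrite mxE; case: (a == b); rewrite ?mulr1n ?mulr0n ?normr0 //.
    exact: (elimT (mx_norm_leP g (normr_ge0 g)) (lexx _)).
  - rewrite /e (bigD1 i) //= lerDl; exact: sumr_ge0.
  - by exists g.
have ch k : h x 0 k @[x --> 0] --> 0.
  apply: norm_cvg0; apply: (@squeeze_cvgr _ _ _ _ (fun=> 0) (fun x => 2 * e x)).
  - near=> x; rewrite normr_ge0 /=.
    have [hx _] : good x (h x) by near: x.
    by move: k; apply/mx_norm_leP => //; rewrite mulr_ge0.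
  - exact: cvg_cst.
  - rewrite -[X in _ --> X](mulr0 2); apply: cvgM => //; exact: cvg_cst.
have cDh i j : (D0 + x *: B + diag_mx (h x)) i j @[x --> 0] --> D0 i j.
  rewrite -[X in _ --> X]addr0; under eq_fun do rewrite [_ i j]mxE.
  apply: cvgD => //; under eq_fun do rewrite mxE.
  case: (i == j); first by under eq_fun do rewrite mulr1n; exact: ch.
  under eq_fun do rewrite mulr0n; exact: cvg_cst.
have V0eig := adj_eigvecsP det0.
(* If column [j] vanished, so would its entry [j], and the defect at [(j, j)] would be 1, above the
   allowed bound. *)
have V0n0 j : \sum_k (adj_eigvecs th D0) k j ^+ 2 != 0.
  apply: contraTneq (small j j) => /eqP; rewrite psumr_eq0; last first.
    by move=> k _; exact: sqr_ge0.
  move=> /allP /(_ j); rewrite mem_index_enum sqrf_eq0 !mxE => /(_ isT) /eqP cof0.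
  rewrite /defect eqxx cof0 mul0r subr0 normr1 -leNgt invf_le1 ?mulr_gt0 //.
  by rewrite -natrM ler1n.
have [s s1 sP] := normalize_cols_limit thI D0sym PP DP V0eig V0n0.
pose V x := adj_eigvecs th (D0 + x *: B + diag_mx (h x)).
have cV i j : V x i j @[x --> 0] --> adj_eigvecs th D0 i j.
  by rewrite mxE; under eq_fun do rewrite mxE; exact: cvg_adj.
exists h, (fun x => normalize_cols s (V x)); split => //.
  by move=> i j; rewrite -sP; exact: cvg_normalize_cols.
have Vn0 : \forall x \near 0, forall j, \sum_k V x k j ^+ 2 != 0.
  apply: (filter_forall (nbhs_filter (0 : R))) => j; apply: (@cvgr_neq0 R R _ _ _ _ _ _ (V0n0 j)).
  apply: cvg_big => [|k _]; first exact: add_continuous.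
  by under eq_fun do rewrite expr2; rewrite expr2; apply: cvgM; exact: cV.
near=> x.
have [_ detx] : good x (h x) by near: x.
have Veig := adj_eigvecsP detx.
split; last exact: normalize_cols_eigen.
apply: (normalize_cols_orthogonal thI _ Veig s1).
  by rewrite !linearD /= tr_diag_mx D0sym linearZ /= Bsym.
by near: x.
Unshelve. all: by end_near. Qed.

End IsospectralPerturbation.

(** * Generic edge weights *)

Lemma nonroot_exists (R : numDomainType) (p : {poly R}) : p != 0 -> exists t, ~~ root p t.
Proof.
move=> p0; pose s := [seq i%:R : R | i <- iota 0 (size p)].
have s_uniq : uniq s by rewrite map_inj_uniq ?iota_uniq //; exact: mulrIn (oner_neq0 R).
have [sroot|/allPn[t _ pt]] := boolP (all (root p) s); last by exists t.
by have := max_poly_roots p0 sroot s_uniq; rewrite size_map size_iota ltnn.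
Qed.

(** Take [b i = t ^+ i] on the support [nb]. The pairing with [y] is then a nonzero polynomial in
    [t], and [t] is chosen off the roots of all these polynomials and of ['X]. *)
Lemma generic_vector (R : numDomainType) (n : nat) (nb : pred 'I_n) (Y : seq 'cV[R]_n) :
  (forall y, y \in Y -> forall i, y i 0 != 0) ->
  exists2 b : 'cV[R]_n, (forall i, (b i 0 != 0) = nb i) &
    forall y, y \in Y -> (exists i, nb i) -> \sum_i b i 0 * y i 0 != 0.
Proof.
move=> Y0; have [/existsP[i0 nbi0]|nb0] := boolP [exists i, nb i]; last first.
  exists 0 => [i|y _ [i nbi]]; rewrite ?mxE ?eqxx.
    by apply/esym; apply: contraNF nb0 => nbi; apply/existsP; exists i.
  by move/existsPn/(_ i): nb0; rewrite nbi.
pose q (y : 'cV[R]_n) := \sum_(i | nb i) y i 0 *: 'X^i.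
have q0 y : y \in Y -> q y != 0.
  move=> yY; apply: contraTneq (Y0 y yY i0) => qy0; rewrite negbK.
  move/polyP/(_ i0): qy0; rewrite coef0 coef_sum (bigD1 i0) //= coefZ coefXn eqxx mulr1.
  rewrite big1 ?addr0 => [->//|i /andP[_ ii0]].
  by rewrite coefZ coefXn eq_sym (negPf (_ : val i != val i0)) ?mulr0.
have [|t] := @nonroot_exists R ('X * \prod_(y <- Y) q y).
  rewrite mulf_neq0 ?polyX_eq0 // prodf_seq_neq0.
  by apply/allP => y /q0.
rewrite rootM negb_or rootX => /andP[t0 tY].
exists (\col_i (if nb i then t ^+ i else 0)) => [i|y yY _].
  by rewrite mxE; case: ifP => _; rewrite ?expf_neq0 ?eqxx.
have : ~~ root (q y) t.
  by apply: contra tY => qt; rewrite (big_rem y) //= rootM qt.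
rewrite /root /q horner_sum; apply: contra => /eqP sum0; apply/eqP.
rewrite -[RHS]sum0 big_mkcond /=; apply: eq_bigr => i _.
by rewrite mxE; case: ifP; rewrite ?mul0r // hornerZ hornerXn mulrC.
Qed.

(** * Adding one vertex: bordered matrices *)

Definition bordered {R : pzRingType} {n : nat} (a : R) (b : 'cV[R]_n) (A : 'M[R]_n) :
    'M[R]_(1 + n) :=
  block_mx a%:M b^T b A.

Lemma borderedE (R : pzRingType) (n : nat) (a : R) (b : 'cV[R]_n) (A : 'M[R]_n) :
  (bordered a b A (lshift n 0) (lshift n 0) = a) *
  (forall i, bordered a b A (rshift 1 i) (lshift n 0) = b i 0) *
  (forall i, bordered a b A (lshift n 0) (rshift 1 i) = b i 0) *
  (forall i j, bordered a b A (rshift 1 i) (rshift 1 j) = A i j).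
Proof.
split; [split; [split|]|] => *.
- by rewrite block_mxEul mxE.
- by rewrite block_mxEdl.
- by rewrite block_mxEur mxE.
- by rewrite block_mxEdr.
Qed.

Lemma tr_bordered (R : pzRingType) (n : nat) (a : R) (b : 'cV[R]_n) (A : 'M[R]_n) :
  (bordered a b A)^T = bordered a b A^T.
Proof. by rewrite tr_block_mx tr_scalar_mx trmxK. Qed.

Lemma scalar_sub_bordered (R : pzRingType) (n : nat) (s a : R) (b : 'cV[R]_n) (A : 'M[R]_n) :
  s%:M - bordered a b A = bordered (s - a) (- b) (s%:M - A).
Proof.
by rewrite [s%:M]scalar_mx_block opp_block_mx add_block_mx !add0r -raddfB /bordered linearN.
Qed.

Lemma bordered_perturb (R : pzRingType) (n : nat) (a x : R) (b : 'cV[R]_n) (A : 'M[R]_n)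
    (h : 'rV[R]_(1 + n)) :
  bordered a 0 A + x *: bordered 0 b 0 + diag_mx h =
  bordered (a + h 0 (lshift n 0)) (x *: b) (A + diag_mx (rsubmx h)).
Proof.
have addE m (C D : 'M[R]_m) i j : (C + D) i j = C i j + D i j by rewrite mxE.
have scaleE (C : 'M[R]_(1 + n)) i j : (x *: C) i j = x * C i j by rewrite mxE.
have diagE m (d : 'rV[R]_m) i j : diag_mx d i j = d 0 i *+ (i == j) by rewrite mxE.
apply/matrixP => i j; rewrite !addE scaleE diagE.
case: (split_ordP i) => i' ->; case: (split_ordP j) => j' ->; rewrite ?ord1 !borderedE.
- by rewrite eqxx mulr1n mulr0 addr0.
- by rewrite eq_lrshift mulr0n addr0 !mxE add0r.
- by rewrite eq_rlshift mulr0n addr0 !mxE add0r.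
- by rewrite addE diagE eq_rshift !mxE mulr0 addr0.
Qed.

Lemma cofactor_bordered_lower (R : comNzRingType) (n : nat) (a : R) (A : 'M[R]_n) (i j : 'I_n) :
  cofactor (bordered a 0 A) (rshift 1 i) (rshift 1 j) = a * cofactor A i j.
Proof.
case: n A i j => [|n] A i j; first by case: i.
rewrite /cofactor mulrCA; congr (_ * _).
  by rewrite /= addnACA exprD sqrrN expr1n mul1r.
have El (k : 'I_n.+1) : lift (rshift 1 k) (lshift n (0 : 'I_1)) = lshift n.+1 (0 : 'I_1).
  exact/val_inj.
have Er (k : 'I_n.+1) y : lift (rshift 1 k) (rshift 1 y) = rshift 1 (lift k y).
  by apply/val_inj; rewrite /= /bump /= !add1n ltnS addnS.
rewrite [row' _ _](_ : _ = block_mx a%:M 0 0 (row' i (col' j A)) :> 'M_(1 + n)).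
  by have := @det_ublock R 1 n a%:M 0 (row' i (col' j A)); rewrite det_scalar1.
apply/matrixP => x y; rewrite mxE [col' _ _ _ _]mxE.
case: (split_ordP x) => x' ->; case: (split_ordP y) => y' ->;
  rewrite ?ord1 ?El ?Er borderedE.
- by rewrite block_mxEul mxE.
- by rewrite block_mxEur !mxE.
- by rewrite block_mxEdl !mxE.
- by rewrite block_mxEdr !mxE.
Qed.

Lemma cofactor_bordered_corner (R : comNzRingType) (n : nat) (a : R) (b : 'cV[R]_n)
    (A : 'M[R]_n) :
  cofactor (bordered a b A) (lshift n 0) (lshift n 0) = \det A.
Proof.
rewrite /cofactor mul1r; congr (\det _); apply/matrixP => x y; rewrite mxE [col' _ _ _ _]mxE.
have E (k : 'I_n) : lift (lshift n (0 : 'I_1)) k = rshift 1 k by exact/val_inj.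
by have := (borderedE a b A).2 x y; rewrite -!E.
Qed.

Lemma gap_lshift (R : fieldType) (n : nat) (th : 'I_(1 + n) -> R) :
  gap th (lshift n 0) = \prod_k (th (lshift n 0) - th (rshift 1 k)).
Proof.
rewrite /gap big_mkcond big_split_ord /= big_ord1 eqxx mul1r.
by [].
Qed.

Lemma gap_rshift (R : fieldType) (n : nat) (th : 'I_(1 + n) -> R) (i : 'I_n) :
  gap th (rshift 1 i) = (th (rshift 1 i) - th (lshift n 0)) * gap (th \o @rshift 1 n) i.
Proof.
rewrite /gap big_mkcond big_split_ord /= big_ord1 eq_lrshift; congr (_ * _).
by rewrite [RHS]big_mkcond /=; apply: eq_bigr => k _; rewrite eq_rshift.
Qed.

(** In a direct sum the new eigenvalue responds only to the corner entry, with derivative 1, and the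
    old ones only to the diagonal of [A]: the factor [th i - th l], with [l] the corner index,
    cancels between cofactor and gap. *)
Lemma defect_bordered (R : fieldType) (n : nat) (th : 'I_(1 + n) -> R) (A : 'M[R]_n) :
  injective th ->
  (forall s, \det (s%:M - A) = \prod_j (s - th (rshift 1 j))) ->
  forall i k, defect th (bordered (th (lshift n 0)) 0 A) i k = 0 \/
    exists i' k',
      defect th (bordered (th (lshift n 0)) 0 A) i k = defect (th \o @rshift 1 n) A i' k'.
Proof.
move=> thI detA i k; rewrite /defect scalar_sub_bordered oppr0.
case: (split_ordP i) => i' ->; case: (split_ordP k) => k' ->; rewrite ?ord1.
- left; rewrite eqxx cofactor_bordered_corner detA gap_lshift divff ?subrr //.
  by rewrite -gap_lshift gap_neq0.
- by left; rewrite eq_lrshift cofactor_bordered_lower subrr !mul0r subrr.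
- left; rewrite eq_rlshift cofactor_bordered_corner detA (bigD1 i') //=.
  by rewrite subrr !mul0r subrr.
- right; exists i', k'; rewrite eq_rshift cofactor_bordered_lower gap_rshift.
  rewrite invfM mulrACA divff ?mul1r // subr_eq0 (inj_eq thI).
  by rewrite eq_rlshift.
Qed.

(** The first row of the eigenvector equation. *)
Lemma bordered_eigvec_corner (R : comNzRingType) (n : nat) (a : R) (b : 'cV[R]_n) (A : 'M[R]_n)
    (P : 'M[R]_(1 + n)) (th : 'I_(1 + n) -> R) (j : 'I_(1 + n)) :
  bordered a b A *m P = P *m diag_mx (\row_j th j) ->
  (th j - a) * P (lshift n 0) j = \sum_u b u 0 * P (rshift 1 u) j.
Proof.
move=> /matrixP/(_ (lshift n 0) j); rewrite mul_mx_diagE !mxE big_split_ord /= big_ord1 borderedE.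
under eq_bigr do rewrite borderedE.
by move=> H; rewrite mulrBl mulrC -H addrAC subrr add0r.
Qed.

(** The lower rows read [(th j - A) y = P_lj b], with [l] the corner index; multiplying by the
    adjugate solves for [y] without division. *)
Lemma bordered_eigvec_lower (R : comNzRingType) (n : nat) (a : R) (b : 'cV[R]_n) (A : 'M[R]_n)
    (P : 'M[R]_(1 + n)) (th : 'I_(1 + n) -> R) (j : 'I_(1 + n)) (i : 'I_n) :
  bordered a b A *m P = P *m diag_mx (\row_j th j) ->
  \det ((th j)%:M - A) * P (rshift 1 i) j =
  P (lshift n 0) j * \sum_u \adj ((th j)%:M - A) i u * b u 0.
Proof.
move=> DP; pose y : 'cV[R]_n := \col_u P (rshift 1 u) j.
have yE : ((th j)%:M - A) *m y = P (lshift n 0) j *: b.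
  rewrite mulmxBl mul_scalar_mx; apply/colP => k.
  have H : b k 0 * P (lshift n 0) j + \sum_u A k u * P (rshift 1 u) j = P (rshift 1 k) j * th j.
    move/matrixP/(_ (rshift 1 k) j): DP.
    rewrite mul_mx_diagE !mxE big_split_ord /= big_ord1 borderedE => <-; congr (_ + _).
    by apply: eq_bigr => u _; rewrite borderedE.
  rewrite !mxE [th j * _]mulrC -H [b k 0 * _]mulrC -addrA -sumrB big1 ?addr0 //.
  by move=> u _; rewrite mxE subrr.
have : \adj ((th j)%:M - A) *m (((th j)%:M - A) *m y) =
    \adj ((th j)%:M - A) *m (P (lshift n 0) j *: b) by rewrite yE.
rewrite mulmxA mul_adj_mx mul_scalar_mx -scalemxAr => /colP/(_ i).
by rewrite mxE [y i 0]mxE [in RHS]mxE => ->; rewrite mxE.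
Qed.

(** An off-diagonal entry, in the first row, of the product of a matrix with its adjugate is
    zero. *)
Lemma bordered_adj_corner (R : comNzRingType) (n : nat) (a s : R) (b : 'cV[R]_n) (A : 'M[R]_n)
    (k : 'I_n) :
  (s - a) * \adj (s%:M - bordered a b A) (lshift n 0) (rshift 1 k) =
  \sum_u b u 0 * \adj (s%:M - bordered a b A) (rshift 1 u) (rshift 1 k).
Proof.
have /matrixP/(_ (lshift n 0) (rshift 1 k)) := mul_mx_adj (s%:M - bordered a b A).
rewrite scalar_sub_bordered mxE [RHS]mxE eq_lrshift mulr0n big_split_ord /= big_ord1 borderedE.
move=> /eqP; rewrite addr_eq0 => /eqP ->; rewrite -sumrN.
by apply: eq_bigr => u _; rewrite borderedE mxE mulNr opprK.
Qed.

(** * Realizing a spectrum on a connected graph with nowhere-zero data *)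

Section NowhereZeroRealization.
Local Open Scope classical_set_scope.

Lemma near_seq (I : eqType) (T : Type) (F : set_system T) (FF : Filter F) (s : seq I)
    (P : I -> T -> Prop) :
  (forall y, y \in s -> \forall x \near F, P y x) ->
  \forall x \near F, forall y, y \in s -> P y x.
Proof.
elim: s => [|a s IHs] Ps; first by apply: nearW.
have Pa := Ps a (mem_head _ _).
have {}IHs : \forall x \near F, forall y, y \in s -> P y x.
  by apply: IHs => y ys; apply: Ps; rewrite inE ys orbT.
apply: filterS2 Pa IHs => x Pax Psx y.
by rewrite inE => /predU1P[->|/Psx].
Qed.

Lemma cvg_sumr (R : realType) (T : Type) (F : set_system T) (FF : Filter F) (I : finType)
    (f : I -> T -> R) (l : I -> R) :
  (forall i, f i x @[x --> F] --> l i) -> \sum_i f i x @[x --> F] --> \sum_i l i.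
Proof. by move=> cf; apply: cvg_big => // ; exact: add_continuous. Qed.

(* Induction on [n]: the first vertex is attached to a realization [A] of the rest by edges of weight
   [x * b u], and the spectrum is restored by [isospectral_perturbation]. The border equations express
   each entry that vanishes at [x = 0] as [x] times a quantity with nonzero limit, because [A] was
   chosen for the longer lists [th l :: S] and [w, w_j / (th_j - th_l)], and [b] is generic. *)
Lemma nowhere_zero_realization (R : realType) (n : nat) (e : rel 'I_n) (th : 'I_n -> R)
    (eps : R) (W : seq 'cV[R]_n) (S : seq R) :
  symmetric e -> (forall i : 'I_n, (i.+1 < n)%N -> exists2 j : 'I_n, (i < j)%N & e i j) ->
  injective th -> 0 < eps -> (forall w, w \in W -> w != 0) ->
  (forall s, s \in S -> forall i, s != th i) ->
  exists (D P : 'M[R]_n),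
  [/\ D^T = D, forall i j, i != j -> (D i j != 0) = e i j, P^T *m P = 1%:M,
      D *m P = P *m diag_mx (\row_j th j) &
  [/\ forall i k, `|defect th D i k| < eps,
      forall w, w \in W -> forall i, (P *m w) i 0 != 0 &
      forall s, s \in S -> forall i j, \adj (s%:M - D) i j != 0]].
Proof.
elim: n e th eps W S => [|n IHn] e th eps W S e_sym eup thI eps0 W0 Sth.
  have mx00 (X Y : 'M[R]_0) : X = Y by rewrite [X]flatmx0 [Y]flatmx0.
  exists 0, 1%:M; split; [exact: mx00| |exact: mx00|exact: mx00|].
  - by case.
  - by split; [case|move=> ? _ []|move=> ? _ []].
pose l : 'I_(1 + n) := lshift n 0; pose r : 'I_n -> 'I_(1 + n) := @rshift 1 n.
have rI : injective r := @rshift_inj 1 n.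
have lr i : (l == r i) = false := @eq_lrshift 1 n 0 i.
pose low (w : 'cV[R]_(1 + n)) : 'cV[R]_n := dsubmx w.
pose W1 := [seq w <- W | low w != 0].
pose res (w : 'cV[R]_(1 + n)) : 'cV[R]_n := \col_j (low w j 0 / (th (r j) - th l)).
have thlr j : th (r j) - th l != 0.
  by rewrite subr_eq0 (inj_eq thI) eq_sym lr.
have res0 w : low w != 0 -> res w != 0.
  apply: contraNneq => resw; apply/eqP/colP => j; move/colP/(_ j): resw.
  rewrite !mxE => /eqP; rewrite mulf_eq0 invr_eq0 (negPf (thlr j)) orbF => /eqP.
  by [].
(* The second bound is the one under which the perturbed spectrum can be restored. *)
pose eps1 := Num.min eps (2 * n.+1%:R)^-1.
have [||||||A [Q [Asym Apat QQ AQ [Adef Qlow Aadj]]]] :=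
  IHn (fun i j => e (r i) (r j)) (th \o r) eps1
      ([seq low w | w <- W1] ++ [seq res w | w <- W1]) (th l :: S).
- by move=> i j; exact: e_sym.
- move=> i ilt; have [|j] := eup (r i); first by rewrite /= add1n ltnS.
  case: (@split_ordP 1 n j) => j' ->; first by rewrite ord1.
  by move=> ij eij; exists j'.
- by apply: inj_comp.
- by rewrite lt_min eps0 /= invr_gt0 mulr_gt0.
- move=> w; rewrite mem_cat => /orP[] /mapP[w' + ->]; rewrite mem_filter => /andP[w'0 _] //.
  exact: res0.
- move=> s; rewrite inE => /predU1P[->|sS] i /=; last exact: Sth.
  by rewrite -subr_eq0 -oppr_eq0 opprB thlr.
have Qu : Q \in unitmx by case/mulmx1_unit: QQ.
have detA s : \det (s%:M - A) = \prod_j (s - th (r j)).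
  by rewrite (det_eigen0 _ Qu AQ); apply: eq_bigr => j _; rewrite mxE.
have adjsym s i j : \adj (s%:M - A) i j = \adj (s%:M - A) j i.
  have := trmx_adj (s%:M - A); rewrite linearB /= tr_scalar_mx Asym.
  by move=> /matrixP/(_ i j); rewrite [LHS]mxE => ->.
pose nb : pred 'I_n := fun u => e l (r u).
(* The given [u] witnesses that the remaining graph is nonempty, so [l] is not the last vertex and
   has a neighbour there. *)
have nbex (u : 'I_n) : exists u, nb u.
  have [|j] := eup l; first by rewrite ltnS (leq_ltn_trans (leq0n u)).
  by case: (@split_ordP 1 n j) => j' ->; [rewrite ord1 ltnn|exists j'].
(* Up to nonzero factors, the pairings of [b] with these vectors are the first-order coefficients in
   [x] of the entries that vanish at [x = 0]. *)
have [|b bpat bY] := @generic_vector R n nb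
  ([seq Q *m res w | w <- W1] ++ [seq col k (\adj (s%:M - A)) | s <- th l :: S, k <- enum 'I_n]).
  move=> y; rewrite mem_cat => /orP[/mapP[w wW ->] i|/allpairsP[[s k] /= [sS _ ->]] i].
    by apply: Qlow; rewrite mem_cat map_f ?orbT.
  by rewrite mxE; exact: Aadj.
have bres w : w \in W -> low w != 0 -> \sum_u b u 0 * (Q *m res w) u 0 != 0.
  move=> wW w0; apply: bY.
    rewrite mem_cat; apply/orP; left; apply: (map_f (fun w => Q *m res w)).
    by rewrite mem_filter w0.
  by move/cV0Pn: w0 => [u _]; exact: nbex u.
have badj s k : s \in th l :: S -> \sum_u b u 0 * \adj (s%:M - A) u k != 0.
  move=> sS; have := bY (col k (\adj (s%:M - A))) _ (nbex k).
  rewrite (eq_bigr (fun u => b u 0 * \adj (s%:M - A) u k)) => [|u _]; last first.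
    by rewrite [X in _ * X]mxE.
  apply; rewrite mem_cat; apply/orP; right.
  by apply/allpairsP; exists (s, k); rewrite mem_enum.
pose D0 := bordered (th l) 0 A; pose P0 := bordered 1 0 Q.
pose Th : 'M[R]_(1 + n) := diag_mx (\row_j th j).
have P0P0 : P0^T *m P0 = 1%:M.
  rewrite /P0 tr_bordered /bordered mulmx_block !trmx0 !(mulmx0, mul0mx) QQ !addr0 !add0r mulmx1.
  by rewrite -scalar_mx_block.
have D0P0 : D0 *m P0 = P0 *m Th.
  have -> : Th = block_mx (th l)%:M 0 0 (diag_mx (\row_j (th \o r) j)).
    apply/matrixP => i j; rewrite [LHS]mxE.
    case: (split_ordP i) => i' ->; case: (split_ordP j) => j' ->; rewrite ?ord1.
    - by rewrite block_mxEul eqxx !mxE.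
    - by rewrite block_mxEur [RHS]mxE.
    - by rewrite block_mxEdl [RHS]mxE.
    - by rewrite block_mxEdr !mxE; congr (_ *+ nat_of_bool _); exact: eq_rshift.
  rewrite /D0 /P0 /bordered !mulmx_block !trmx0 !(mulmx0, mul0mx) AQ !addr0 !add0r.
  by rewrite mulmx1 mul1mx.
have D0def i k : `|defect th D0 i k| < eps1.
  have [->|[i' [k' ->]]] := defect_bordered thI detA i k; last exact: Adef.
  by rewrite normr0 lt_min eps0 /= invr_gt0 mulr_gt0.
have D0sym : D0^T = D0 by rewrite tr_bordered Asym.
have Bsym : (bordered 0 b 0)^T = bordered 0 b (0 : 'M[R]_n) by rewrite tr_bordered trmx0.
have [|h [P [ch cD cP eig]]] :=
    @isospectral_perturbation R n th D0 (bordered 0 b 0) P0 thI D0sym Bsym P0P0 D0P0.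
  by move=> i k; apply: lt_le_trans (D0def i k) _; rewrite ge_min lexx orbT.
pose a x := th l + h x 0 l; pose A' x := A + diag_mx (@rsubmx R 1 1 n (h x)).
pose D x := bordered (a x) (x *: b) (A' x).
have DE x : D0 + x *: bordered 0 b 0 + diag_mx (h x) = D x by exact: bordered_perturb.
have {}cD i j : D x i j @[x --> (0 : R)] --> D0 i j.
  by have := cD i j; under eq_fun do rewrite DE.
have {}eig : \forall x \near (0 : R), (P x)^T *m P x = 1%:M /\ D x *m P x = P x *m Th.
  by apply: filterS eig => x; rewrite DE.
have cA' i j : A' x i j @[x --> (0 : R)] --> A i j.
  have := cD (r i) (r j); rewrite borderedE.
  by under eq_fun do rewrite borderedE.
have ca : a x @[x --> (0 : R)] --> th l.
  have := cD l l; rewrite borderedE.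
  by under eq_fun do rewrite borderedE.
have P0E := borderedE 1 0 Q.
have near_def : \forall x \near (0 : R), forall i k, `|defect th (D x) i k| < eps.
  apply: (filter_forall (nbhs_filter (0 : R))) => i.
  apply: (filter_forall (nbhs_filter (0 : R))) => k.
  have /cvgr_norm_lt := @cvg_defect R _ _ (nbhs_filter (0 : R)) _ th D D0 i k cD; apply.
  by apply: lt_le_trans (D0def i k) _; rewrite ge_min lexx.
have cPw (w : 'cV[R]_(1 + n)) i : (P x *m w) i 0 @[x --> (0 : R)] --> (P0 *m w) i 0.
  rewrite mxE; under eq_fun do rewrite mxE.
  by apply: cvg_sumr => j; apply: cvgM; [exact: cP|exact: cvg_cst].
have mulE (V : 'M[R]_(1 + n)) (w : 'cV[R]_(1 + n)) i :
    (V *m w) i 0 = V i l * w l 0 + \sum_j V i (r j) * low w j 0.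
  by rewrite mxE big_split_ord /= big_ord1; under [X in _ = _ + X]eq_bigr do rewrite mxE.
have P0wl (w : 'cV[R]_(1 + n)) : (P0 *m w) l 0 = w l 0.
  by rewrite mulE P0E mul1r big1 ?addr0 // => j _; rewrite P0E mxE mul0r.
have P0wr (w : 'cV[R]_(1 + n)) i : (P0 *m w) (r i) 0 = (Q *m low w) i 0.
  rewrite mulE [RHS]mxE P0E [X in X * _]mxE mul0r add0r.
  by apply: eq_bigr => j _; rewrite P0E.
have near_col : \forall x \near (0 : R), x != 0 -> forall i, P x (r i) l != 0.
  have cG i : \sum_u \adj ((th l)%:M - A' x) i u * b u 0 @[x --> (0 : R)] -->
      \sum_u \adj ((th l)%:M - A) i u * b u 0.
    apply: cvg_sumr => u; apply: cvgM; last exact: cvg_cst.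
    exact: (@cvg_adj R _ _ (nbhs_filter (0 : R)) _ _ A' A i u cA').
  have G0 i : \sum_u \adj ((th l)%:M - A) i u * b u 0 != 0.
    have := badj (th l) i (mem_head _ _).
    by under eq_bigr do rewrite mulrC adjsym.
  have nearG : \forall x \near (0 : R), forall i,
      \sum_u \adj ((th l)%:M - A' x) i u * b u 0 != 0.
    apply: (filter_forall (nbhs_filter (0 : R))) => i.
    by apply: (cvgr_neq0 _ (cG i)).
  have nearll : \forall x \near (0 : R), P x l l != 0.
    apply: (cvgr_neq0 _ (cP l l)); rewrite P0E; exact: oner_neq0.
  near=> x => x0 i.
  have [_ DP] : (P x)^T *m P x = 1%:M /\ D x *m P x = P x *m Th by near: x.
  have E := bordered_eigvec_lower l i DP.
  apply: contra_eq_neq E => ->; rewrite mulr0 eq_sym mulf_neq0 //; first by near: x.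
  under eq_bigr do rewrite [(x *: b) _ _]mxE mulrCA.
  rewrite -mulr_sumr mulf_neq0 //; move: i; near: x; exact: nearG.
have near_row w : w \in W -> low w != 0 -> w l 0 = 0 ->
    \forall x \near (0 : R), x != 0 -> (P x *m w) l 0 != 0.
  move=> wW low0 wl.
  (* The quotient of [(P x *m w) l 0] by [x], obtained from the corner equation; its limit is the
     pairing of [b] with [Q *m res w]. *)
  pose G x := \sum_j (\sum_u b u 0 * P x (r u) (r j)) / (th (r j) - a x) * low w j 0.
  have cden j : th (r j) - a x @[x --> (0 : R)] --> th (r j) - th l.
    by apply: cvgB; [exact: cvg_cst|exact: ca].
  have cG : G x @[x --> (0 : R)] -->
      \sum_j (\sum_u b u 0 * Q u j) / (th (r j) - th l) * low w j 0.
    apply: cvg_sumr => j; apply: cvgM; last exact: cvg_cst.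
    apply: cvgM; last by apply: cvgV.
    apply: cvg_sumr => u; apply: cvgM; first exact: cvg_cst.
    by rewrite -P0E; exact: cP.
  have G0 : \sum_j (\sum_u b u 0 * Q u j) / (th (r j) - th l) * low w j 0 != 0.
    have := bres w wW low0; apply: contra_neq => G00; rewrite -[RHS]G00.
    under [LHS]eq_bigr do rewrite mxE mulr_sumr.
    apply: (etrans (exchange_big _ _ _ _ _ _)); apply: eq_bigr => j _ /=.
    rewrite -mulrA mulr_suml; apply: eq_bigr => u _.
    by rewrite mxE -mulrA [_^-1 * _]mulrC.
  have nearG : \forall x \near (0 : R), G x != 0 by apply: (cvgr_neq0 _ cG).
  have nearden : \forall x \near (0 : R), forall j, th (r j) - a x != 0.
    by apply: (filter_forall (nbhs_filter (0 : R))) => j; apply: (cvgr_neq0 _ (cden j)).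
  near=> x => x0.
  have [_ DP] : (P x)^T *m P x = 1%:M /\ D x *m P x = P x *m Th by near: x.
  have den : forall j, th (r j) - a x != 0 by near: x.
  rewrite mulE wl mulr0 add0r.
  rewrite (_ : \sum_j _ = x * G x); last first.
    rewrite mulr_sumr; apply: eq_bigr => j _; rewrite !mulrA; congr (_ * _).
    have := bordered_eigvec_corner (r j) DP.
    under eq_bigr do rewrite [(x *: b) _ _]mxE -mulrA.
    by rewrite -mulr_sumr => <-; rewrite mulrAC divff ?mul1r.
  by rewrite mulf_neq0 //; near: x.
have near_w : \forall x \near (0 : R), forall w, w \in W -> x != 0 ->
    forall i, (P x *m w) i 0 != 0.
  apply: (near_seq (nbhs_filter (0 : R))) => w wW.
  have wlE : low w = 0 -> forall x i, (P x *m w) i 0 = P x i l * w l 0.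
    move=> low0 x i; rewrite mulE low0 big1 ?addr0 // => j _.
    by rewrite mxE mulr0.
  have wl0 : low w = 0 -> w l 0 != 0.
    move=> low0; apply: contraNneq (W0 w wW) => wl; apply/eqP/colP => i; rewrite [RHS]mxE.
    case: (@split_ordP 1 n i) => j ->; first by rewrite ord1.
    by move/colP/(_ j): low0; rewrite !mxE.
  have near_l : \forall x \near (0 : R), x != 0 -> (P x *m w) l 0 != 0.
    have [wl|wl] := eqVneq (w l 0) 0.
      apply: near_row => //; apply: contra_eqN wl => /eqP; exact: wl0.
    near=> x => _; near: x; apply: (cvgr_neq0 _ (cPw w l)); by rewrite P0wl.
  (* If [low w = 0], then [P x *m w] is a nonzero multiple of column [l]; otherwise the limit
     [Q *m low w] is nowhere zero. *)
  have near_r : \forall x \near (0 : R), x != 0 -> forall i, (P x *m w) (r i) 0 != 0.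
    have [low0|low0] := eqVneq (low w) 0.
      apply: filterS near_col => x col x0 i; rewrite wlE //.
      by rewrite mulf_neq0 ?col ?wl0.
    near=> x => _; near: x; apply: (filter_forall (nbhs_filter (0 : R))) => i.
    apply: (cvgr_neq0 _ (cPw w (r i))); rewrite P0wr Qlow // mem_cat.
    by apply/orP; left; apply: map_f; rewrite mem_filter low0.
  apply: filterS2 near_l near_r => x Hl Hr x0 i.
  by case: (@split_ordP 1 n i) => j ->; [rewrite ord1; exact: Hl|exact: Hr].
have Dsym x : (D x)^T = D x by rewrite tr_bordered linearD /= Asym tr_diag_mx.
have adjDsym s x i j : \adj (s%:M - D x) i j = \adj (s%:M - D x) j i.
  have := trmx_adj (s%:M - D x); rewrite linearB /= tr_scalar_mx Dsym.
  by move=> /matrixP/(_ i j); rewrite [LHS]mxE => ->.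
have near_s : \forall x \near (0 : R), forall s, s \in S -> x != 0 ->
    forall i j, \adj (s%:M - D x) i j != 0.
  apply: (near_seq (nbhs_filter (0 : R))) => s sS.
  have sl : s - th l != 0 by rewrite subr_eq0 Sth.
  have cadj i j : \adj (s%:M - D x) i j @[x --> (0 : R)] --> \adj (s%:M - D0) i j.
    exact: (@cvg_adj R _ _ (nbhs_filter (0 : R)) _ s D D0 i j cD).
  have adj0 i j : \adj (s%:M - D0) (r i) (r j) = (s - th l) * \adj (s%:M - A) i j.
    by rewrite [LHS]mxE [\adj _ i j]mxE scalar_sub_bordered oppr0 cofactor_bordered_lower.
  have near_ll : \forall x \near (0 : R), \adj (s%:M - D x) l l != 0.
    apply: (cvgr_neq0 _ (cadj l l)).
    rewrite [\adj _ _ _]mxE scalar_sub_bordered cofactor_bordered_corner detA.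
    by apply/prodf_neq0 => j _; rewrite subr_eq0 Sth.
  have near_rr : \forall x \near (0 : R), forall i j, \adj (s%:M - D x) (r i) (r j) != 0.
    apply: (filter_forall (nbhs_filter (0 : R))) => i.
    apply: (filter_forall (nbhs_filter (0 : R))) => j.
    apply: (cvgr_neq0 _ (cadj (r i) (r j))); rewrite adj0 mulf_neq0 // Aadj //.
    by rewrite inE sS orbT.
  (* These entries vanish at [x = 0]; multiplied by [s - a x] they equal [x] times a quantity with
     nonzero limit. *)
  have near_lr : \forall x \near (0 : R), x != 0 -> forall k, \adj (s%:M - D x) l (r k) != 0.
    have cG k : \sum_u b u 0 * \adj (s%:M - D x) (r u) (r k) @[x --> (0 : R)] -->
        \sum_u b u 0 * \adj (s%:M - D0) (r u) (r k).
      by apply: cvg_sumr => u; apply: cvgM; [exact: cvg_cst|exact: cadj].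
    have nearG : \forall x \near (0 : R), forall k,
        \sum_u b u 0 * \adj (s%:M - D x) (r u) (r k) != 0.
      apply: (filter_forall (nbhs_filter (0 : R))) => k; apply: (cvgr_neq0 _ (cG k)).
      under eq_bigr do rewrite adj0 mulrCA.
      by rewrite -mulr_sumr mulf_neq0 // badj // inE sS orbT.
    apply: filterS nearG => x Gx x0 k.
    apply: contra_neq (mulf_neq0 x0 (Gx k)) => adj00.
    have := bordered_adj_corner (a x) s (x *: b) (A' x) k.
    rewrite adj00 mulr0 mulr_sumr => /esym E; rewrite -[RHS]E.
    by apply: eq_bigr => u _; rewrite [(x *: b) _ _]mxE mulrA.
  apply: filterS3 near_ll near_rr near_lr => x Hll Hrr Hlr x0 i j.
  case: (@split_ordP 1 n i) => i' ->; case: (@split_ordP 1 n j) => j' ->; rewrite ?ord1.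
  - exact: Hll.
  - exact: Hlr.
  - by rewrite adjDsym; exact: Hlr.
  - exact: Hrr.
have /nbhs_ballP[d /= d0 ball_d] : \forall x \near (0 : R),
    [/\ (P x)^T *m P x = 1%:M /\ D x *m P x = P x *m Th,
        forall i k, `|defect th (D x) i k| < eps,
        forall w, w \in W -> x != 0 -> forall i, (P x *m w) i 0 != 0 &
        forall s, s \in S -> x != 0 -> forall i j, \adj (s%:M - D x) i j != 0].
  near=> x; split; by near: x.
(* Any nonzero parameter in the ball would do; half the radius is taken. *)
have x0 : d / 2 != 0 by rewrite mulf_neq0 ?invr_neq0 // gt_eqF.
have [|[PP DP] xdef xw xs] := ball_d (d / 2).
  by rewrite /ball /= sub0r normrN gtr0_norm ?divr_gt0 // ltr_pdivrMr // ltr_pMr // ltr1n.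
exists (D (d / 2)), (P (d / 2)); split => //; last first.
  by split=> // [w wW|s sS]; [exact: xw|exact: xs].
have lpat u : (d / 2 * b u 0 != 0) = e l (r u) by rewrite mulf_eq0 (negPf x0) bpat.
move=> i j; case: (@split_ordP 1 n i) => i' ->; case: (@split_ordP 1 n j) => j' ->.
- by rewrite !ord1 eqxx.
- by move=> _; rewrite !ord1 borderedE mxE lpat.
- by move=> _; rewrite !ord1 borderedE mxE lpat e_sym.
- rewrite borderedE => ij; have {}ij : i' != j' by apply: contraNneq ij => ->.
  by rewrite -Apat // mxE [diag_mx _ _ _]mxE (negPf ij) addr0.
Unshelve. all: by end_near.
Qed.

End NowhereZeroRealization.

(** * Characteristic polynomials and orthogonal diagonalization *)

Lemma char_poly_similar (R : fieldType) (n : nat) (A B S : 'M[R]_n) :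
  S \in unitmx -> A *m S = S *m B -> char_poly A = char_poly B.
Proof.
move=> Su AS; pose S' := map_mx polyC S.
have detS : \det S' != 0 by rewrite det_map_mx polyC_eq0 -unitfE -unitmxE.
have : char_poly_mx A *m S' = S' *m char_poly_mx B.
  by rewrite /char_poly_mx mulmxBl mulmxBr -!map_mxM AS mul_scalar_mx mul_mx_scalar.
move=> /(congr1 determinant); rewrite !det_mulmx [RHS]mulrC.
by move/(mulIf detS).
Qed.

(** Two enumerations differ by a permutation, so the two matrices are similar. This permits listing
    the vertices block by block. *)
Lemma char_poly_reindex (R : fieldType) (T : finType) (N : T -> T -> R) (n m : nat)
    (f : 'I_n -> T) (g : 'I_m -> T) :
  bijective f -> bijective g ->
  char_poly (\matrix_(i, j) N (f i) (f j)) = char_poly (\matrix_(i, j) N (g i) (g j)).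
Proof.
move=> bf [g' gK g'K].
have nm : n = m.
  by rewrite -[n]card_ord -[m]card_ord (bij_eq_card bf); apply/esym/bij_eq_card; exists g'.
move: nm f bf => -> {n} f bf.
have sI : injective (g' \o f) by apply: inj_comp; [exact: can_inj g'K|exact: bij_inj].
pose s := perm sI.
have gs i : g (s i) = f i by rewrite permE /= g'K.
apply: (@char_poly_similar _ _ _ _ (perm_mx s)); first exact: unitmx_perm.
rewrite -row_permE -[s in LHS]invgK -col_permE.
by apply/matrixP => i j; rewrite !mxE -!gs permKV.
Qed.

Lemma char_poly_castmx (R : nzRingType) (m n : nat) (eq_mn : m = n) (A : 'M[R]_m) :
  char_poly (castmx (eq_mn, eq_mn) A) = char_poly A.
Proof. by case: n / eq_mn; rewrite castmx_id. Qed.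

Lemma char_poly_block_diag (R : comNzRingType) (m n : nat) (A : 'M[R]_m) (B : 'M[R]_n) :
  char_poly (block_mx A 0 0 B) = char_poly A * char_poly B.
Proof.
rewrite /char_poly /char_poly_mx map_block_mx !map_mx0 [_%:M]scalar_mx_block.
by rewrite opp_block_mx add_block_mx !oppr0 !addr0 det_ublock.
Qed.

Lemma char_poly_diag_mx (R : comNzRingType) (n : nat) (d : 'rV[R]_n) :
  char_poly (diag_mx d) = \prod_j ('X - (d 0 j)%:P).
Proof.
rewrite /char_poly (_ : char_poly_mx _ = diag_mx (\row_j ('X - (d 0 j)%:P))).
  by rewrite det_diag; apply: eq_bigr => j _; rewrite mxE.
by apply/matrixP => i j; rewrite !mxE raddfMn /= mulrnBl.
Qed.

(** The roots are given and distinct, so one normalized eigenvector per root already forms an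
    orthonormal basis. *)
Lemma symmetric_diagonalization (R : rcfType) (n : nat) (C : 'M[R]_n) (lam : 'I_n -> R) :
  C^T = C -> injective lam -> char_poly C = \prod_j ('X - (lam j)%:P) ->
  exists2 Q : 'M[R]_n, Q^T *m Q = 1%:M & C *m Q = Q *m diag_mx (\row_j lam j).
Proof.
move=> Csym lamI charC.
have /fin_all_exists2[v Cv v0] j : exists2 v : 'rV[R]_n, v *m C = lam j *: v & v != 0.
  apply/eigenvalueP; rewrite eigenvalue_root_char charC (bigD1 j) //= rootM.
  by rewrite root_XsubC eqxx.
pose V : 'M[R]_n := \matrix_(i, j) v j 0 i.
have CV : C *m V = V *m diag_mx (\row_j lam j).
  apply/matrixP => i j; rewrite mul_mx_diagE !mxE mulrC.
  move/rowP/(_ i): (Cv j); rewrite !mxE => <-; apply: eq_bigr => k _.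
  by rewrite mxE mulrC -[C in LHS]Csym mxE.
have V0 j : \sum_k V k j ^+ 2 != 0.
  apply: contraNneq (v0 j) => /eqP; rewrite psumr_eq0 => [/allP sum0|k _]; last exact: sqr_ge0.
  apply/eqP/rowP => k; have := sum0 k (mem_index_enum k).
  by rewrite /= sqrf_eq0 !mxE => /eqP.
exists (normalize_cols (fun=> 1) V); last exact: normalize_cols_eigen.
by apply: (normalize_cols_orthogonal lamI Csym CV) => // j; rewrite expr1n.
Qed.

(** * Ordering the vertices of a connected graph *)

(** The list grows at its head, each new vertex being adjacent to one already present; the seed [x0]
    ends up last. This is the order in which the induction on bordered matrices removes vertices. *)
Lemma connected_ordering (U : finType) (e : rel U) (n : nat) (x0 : U) :
  symmetric e -> graph_connected e -> #|U| = n ->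
  exists2 f : 'I_n -> U, bijective f &
    forall i : 'I_n, (i.+1 < n)%N -> exists2 j : 'I_n, (i < j)%N & e (f i) (f j).
Proof.
move=> e_sym e_conn cardU.
have build k : (k <= n)%N -> exists s : seq U, [/\ uniq s, size s = k &
    forall i, (i.+1 < k)%N -> exists2 j, (i < j < k)%N & e (nth x0 s i) (nth x0 s j)].
  elim: k => [|k IHk] kn; first by exists [::].
  have [s [s_uniq s_size s_adj]] := IHk (ltnW kn).
  have [k0|k_gt0] := posnP k.
    by exists [:: x0]; rewrite k0; split.
  have [z zs [v vs ezv]] : exists2 z, z \notin s & exists2 v, v \in s & e z v.
    (* Without such an edge the list is closed under adjacency, hence contains every vertex by
       connectedness, although it is too short. *)
    apply: contrapT => no.
    have s_closed : closed e (mem s).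
      move=> x y exy; apply/idP/idP => [xs|ys]; apply: contrapT => /negP H; case: no.
        by exists y => //; exists x => //; rewrite e_sym.
      by exists x => //; exists y.
    have sub : (#|U| <= size s)%N.
      rewrite -(card_uniqP s_uniq); apply/subset_leq_card/subsetP => y _.
      rewrite -(closed_connect s_closed (e_conn (nth x0 s 0) y)).
      by apply: mem_nth; rewrite s_size.
    by move: sub; rewrite cardU s_size leqNgt kn.
  exists (z :: s); split => /=; [by rewrite zs|by rewrite s_size|].
  case=> [_|i]; last first.
    by rewrite ltnS => /s_adj[j ij eij]; exists j.+1.
  exists (index v s).+1; first by rewrite /= ltnS -s_size index_mem.
  by rewrite /= nth_index.
have [s [s_uniq s_size s_adj]] := build n (leqnn n).
exists (fun i => nth x0 s i).
  apply: inj_card_bij; last by rewrite card_ord cardU.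
  move=> i j /eqP; rewrite nth_uniq ?s_size // => /eqP; exact: val_inj.
move=> i /s_adj[j /andP[ij jn] eij]; by exists (Ordinal jn).
Qed.

(** * Reduction to arrow matrices *)

(** Conjugation by the block diagonal matrix of the identity and [P]. It serves both for [N], with
    [P], and for [M], with the eigenbasis [Q] of the block on [V2]. *)
Lemma char_poly_arrow (R : fieldType) (a n : nat) (A : 'M[R]_a) (W : 'M[R]_(a, n))
    (D P : 'M[R]_n) (d : 'rV[R]_n) :
  P^T *m P = 1%:M -> D *m P = P *m diag_mx d ->
  char_poly (block_mx A (W *m P^T) (P *m W^T) D) = char_poly (block_mx A W W^T (diag_mx d)).
Proof.
move=> PP DP; apply: (@char_poly_similar _ _ _ _ (block_mx 1%:M 0 0 P)).
  by rewrite unitmxE det_ublock det1 mul1r -unitmxE; case/mulmx1_unit: PP.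
rewrite !mulmx_block !(mulmx0, mul0mx, mulmx1, mul1mx, addr0, add0r).
by rewrite DP -mulmxA PP mulmx1.
Qed.

(** The zero columns decouple the coordinates of [d2], which split off as a direct summand. *)
Lemma char_poly_arrow_split (R : fieldType) (a k t : nat) (A : 'M[R]_a) (W : 'M[R]_(a, k))
    (d1 : 'rV[R]_k) (d2 : 'rV[R]_t) :
  char_poly (block_mx A (row_mx W 0) (row_mx W 0)^T (diag_mx (row_mx d1 d2))) =
  char_poly (block_mx A W W^T (diag_mx d1)) * \prod_i ('X - (d2 0 i)%:P).
Proof.
have -> : diag_mx (row_mx d1 d2) = block_mx (diag_mx d1) 0 0 (diag_mx d2) by rewrite diag_mx_row.
rewrite tr_row_mx trmx0 block_mxA char_poly_castmx.
by rewrite row_mx0 col_mx0 char_poly_block_diag char_poly_diag_mx.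
Qed.

(** * Assembling the matrix on the partial join *)

Theorem theorem3p7 (T : finType) (e : rel T) (V1 V2 : {set T})
  (U : finType) (eH : rel U) (M : T -> T -> Rdefinitions.R)
  (lam : 'I_#|V2| -> Rdefinitions.R) (mu : 'I_(#|U| - #|V2|) -> Rdefinitions.R) :
  simple_graph e ->
  V1 :&: V2 = set0 -> V1 :|: V2 = [set: T] -> V2 != set0 ->
  simple_graph eH -> graph_connected eH -> (#|V2| <= #|U|)%N ->
  in_S e M ->
  injective lam ->
  char_poly (principal_submx M V2) = \prod_(j < #|V2|) ('X - (lam j)%:P) ->
  injective mu ->
  (forall i j, mu i != lam j) ->
  exists N : ({x : T | x \in V1} + U)%type -> ({x : T | x \in V1} + U)%type -> Rdefinitions.R,
    in_S (pjoin e V1 (vboundary e V2) eH) N /\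
    char_poly (mx_of N) =
      char_poly (mx_of M) * \prod_(i < #|U| - #|V2|) ('X - (mu i)%:P).
Proof.
move=> [e_sym e_irr] V12 V12T V20 [eH_sym eH_irr] eH_conn leVU [Msym Mpat] lamI charC muI mulam.
set k := #|V2| in lam lamI charC mulam *; set t := (#|U| - k)%N in mu muI mulam *.
have cardU : #|U| = (k + t)%N by rewrite subnKC.
have k_gt0 : (0 < k)%N by rewrite card_gt0.
have /card_gt0P[u0 _] : (0 < #|U|)%N by rewrite cardU addn_gt0 k_gt0.
have inV12 x : (x \in V1) = (x \notin V2).
  move/setP/(_ x): V12; move/setP/(_ x): V12T; rewrite !inE.
  by case: (x \in V1); case: (x \in V2).
pose C := principal_submx M V2.
have Csym : C^T = C by apply/matrixP => i j; rewrite !mxE.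
have [Q QQ CQ] := symmetric_diagonalization Csym lamI charC.
have Qu : Q \in unitmx by case/mulmx1_unit: QQ.
have [f bij_f f_adj] := connected_ordering u0 eH_sym eH_conn cardU.
pose row2 x : 'rV_k := \row_j M x (@enum_val T (mem V2) j).
(* The row of [x] in the eigenbasis of the block on [V2], extended by zeros in the coordinates of
   [mu]. *)
pose w x : 'cV_(k + t) := col_mx (row2 x *m Q)^T 0.
pose th (i : 'I_(k + t)) := match split i with inl j => lam j | inr j => mu j end.
have thl j : th (lshift t j) = lam j by rewrite /th (unsplitK (inl j)).
have thr j : th (rshift k j) = mu j by rewrite /th (unsplitK (inr j)).
have thI : injective th.
  move=> i j; case: (split_ordP i) => i' ->; case: (split_ordP j) => j' ->; rewrite ?thl ?thr.
  - by move/lamI->.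
  - by move/esym/eqP; rewrite (negPf (mulam _ _)).
  - by move/eqP; rewrite (negPf (mulam _ _)).
  - by move/muI->.
have row2_0 x : x \in V1 -> (row2 x == 0) = (x \notin vboundary e V2).
  rewrite inV12 inE => x2; rewrite x2 /=; apply/eqP/existsPn => [r0 y|noy].
    apply/negP => /andP[yV2 exy].
    have xy : x != y by apply: contraNneq x2 => ->.
    move/rowP/(_ (enum_rank_in yV2 y)): r0; rewrite !mxE enum_rankK_in // => Mxy0.
    by have := Mpat x y xy; rewrite exy Mxy0 eqxx.
  apply/rowP => j; rewrite !mxE; apply/eqP; apply: contraNT (noy (enum_val j)) => Mn0.
  have jV2 : enum_val j \in V2 := enum_valP j.
  by rewrite jV2 -Mpat //; apply: contraNneq x2 => ->.
have w0 x : x \in V1 -> (w x == 0) = (x \notin vboundary e V2).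
  move=> xV1; rewrite -row2_0 // col_mx_eq0 eqxx andbT trmx_eq0.
  by rewrite -[in LHS](mul0mx _ Q) (inj_eq (can_inj (mulmxK Qu))).
(* Only boundary vertices enter the list: for the other vertices of [V1] the vector [w x] is
   zero. *)
have [|||D [P [Dsym Dpat PP DP [_ Pw _]]]] :=
  @nowhere_zero_realization _ (k + t) (fun i j => eH (f i) (f j)) th 1
    [seq w x | x <- enum [pred x | (x \in V1) && (x \in vboundary e V2)]] [::] _ f_adj thI ltr01.
- by move=> i j; exact: eH_sym.
- by move=> y /mapP[x]; rewrite mem_enum inE => /andP[xV1 xB] ->; rewrite w0 // negbK.
- by [].
have [g fK gK] := bij_f.
pose V1T : finType := {x : T | x \in V1}.
pose N (p q : (V1T + U)%type) : Rdefinitions.R :=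
  match p, q with
  | inl x, inl y => M (val x) (val y)
  | inl x, inr u => (P *m w (val x)) (g u) 0
  | inr u, inl y => (P *m w (val y)) (g u) 0
  | inr u, inr v => D (g u) (g v)
  end.
exists N; split.
  have Nw x u : x \in V1 -> ((P *m w x) (g u) 0 != 0) = (x \in vboundary e V2).
    move=> xV1; case: (boolP (x \in _)) => xB.
      by apply: Pw; apply/mapP; exists x => //; rewrite mem_enum inE xV1.
    by move: xB; rewrite -w0 // => /eqP ->; rewrite mulmx0 mxE eqxx.
  split.
    by move=> [x|u] [y|v] //=; rewrite -[in LHS]Dsym mxE.
  move=> [x|u] [y|v] /= pq.
  - exact: Mpat.
  - by apply: Nw; exact: valP.
  - by apply: Nw; exact: valP.
  - rewrite Dpat ?gK //; apply: contraNneq pq => guv.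
    by rewrite -(gK u) guv gK.
pose a := #|V1|.
(* Listing [V1] first gives both [M] and [N] a two by two block form with the same upper left
   block. *)
pose fM (i : 'I_(a + k)) : T :=
  match split i with inl j => @enum_val T (mem V1) j | inr j => @enum_val T (mem V2) j end.
pose fN (i : 'I_(a + (k + t))) : (V1T + U)%type :=
  match split i with
  | inl j => inl (Sub (@enum_val T (mem V1) j) (enum_valP j))
  | inr j => inr (f j) end.
have fMl j : fM (lshift k j) = enum_val j by rewrite /fM (unsplitK (inl j)).
have fMr j : fM (rshift a j) = enum_val j by rewrite /fM (unsplitK (inr j)).
have fNl j : fN (lshift (k + t) j) = inl (Sub (enum_val j) (enum_valP j)).
  by rewrite /fN (unsplitK (inl j)).
have fNr j : fN (rshift a j) = inr (f j) by rewrite /fN (unsplitK (inr j)).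
have bij_fM : bijective fM.
  apply: inj_card_bij; last first.
    by rewrite card_ord -cardsT -V12T cardsU V12 cards0 subn0.
  move=> i j; case: (split_ordP i) => i' ->; case: (split_ordP j) => j' ->; rewrite ?fMl ?fMr.
  - by move/enum_val_inj ->.
  - by move=> E; have := enum_valP i'; rewrite E inV12 (enum_valP j').
  - by move=> E; have := enum_valP j'; rewrite -E inV12 (enum_valP i').
  - by move/enum_val_inj ->.
have bij_fN : bijective fN.
  apply: inj_card_bij; last by rewrite card_ord card_sum cardU leq_add2r card_sig.
  move=> i j; case: (split_ordP i) => i' ->; case: (split_ordP j) => j' ->; rewrite ?fNl ?fNr //.
  - by case=> /enum_val_inj ->.
  - by case=> /(bij_inj bij_f) ->.
pose A := principal_submx M V1.
pose B := \matrix_(i < a, j < k) M (@enum_val T (mem V1) i) (@enum_val T (mem V2) j).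
pose W := row_mx (B *m Q) 0 : 'M_(a, k + t).
have WE i j : W i j = w (enum_val i) j 0.
  case: (split_ordP j) => j' ->; last by rewrite row_mxEr col_mxEd !mxE.
  by rewrite row_mxEl col_mxEu !mxE; apply: eq_bigr => l _; rewrite !mxE.
have -> : char_poly (mx_of M) = char_poly (block_mx A B B^T C).
  rewrite (char_poly_reindex M (@enum_val_bij T) bij_fM); congr char_poly.
  apply/matrixP => i j; rewrite [LHS]mxE.
  case: (split_ordP i) => i' ->; case: (split_ordP j) => j' ->; rewrite ?fMl ?fMr.
  - by rewrite block_mxEul mxE.
  - by rewrite block_mxEur mxE.
  - by rewrite block_mxEdl !mxE Msym.
  - by rewrite block_mxEdr mxE.
have -> : char_poly (mx_of N) = char_poly (block_mx A (W *m P^T) (P *m W^T) D).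
  rewrite (char_poly_reindex N (@enum_val_bij _) bij_fN); congr char_poly.
  have WP i j : (P *m w (enum_val i)) j 0 = (P *m W^T) j i.
    by rewrite !mxE; apply: eq_bigr => l _; rewrite [W^T _ _]mxE WE.
  have tr_PW : W *m P^T = (P *m W^T)^T by rewrite trmx_mul trmxK.
  apply/matrixP => i j; rewrite [LHS]mxE.
  case: (split_ordP i) => i' ->; case: (split_ordP j) => j' ->; rewrite ?fNl ?fNr /= ?fK.
  - by rewrite block_mxEul mxE.
  - by rewrite block_mxEur WP tr_PW [RHS]mxE.
  - by rewrite block_mxEdl WP.
  - by rewrite block_mxEdr.
(* [N] becomes an arrow matrix with diagonal [lam, mu], whose [mu] part is uncoupled. *)
rewrite (char_poly_arrow A W PP DP).
have -> : \row_j th j = row_mx (\row_j lam j) (\row_j mu j).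
  apply/rowP => j; rewrite [LHS]mxE; case: (split_ordP j) => j' ->.
    by rewrite thl row_mxEl mxE.
  by rewrite thr row_mxEr mxE.
rewrite char_poly_arrow_split; congr (_ * _); last by apply: eq_bigr => i _; rewrite mxE.
have BQQ : B *m Q *m Q^T = B by rewrite -mulmxA (mulmx1C QQ) mulmx1.
have QQB : Q *m (B *m Q)^T = B^T by rewrite trmx_mul mulmxA (mulmx1C QQ) mul1mx.
(* The remaining factor is the arrow matrix of [M] itself in the eigenbasis [Q]. *)
by have := char_poly_arrow A (B *m Q) QQ CQ; rewrite BQQ QQB => ->.
Qed.
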